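(* Let $\gamma\ge 2$ be an integer and let $G$ be a connected graph with maximum degree $\Delta\ge 3$. Put $M=\Delta\frac{(\Delta-1)^{\gamma}-1}{\Delta-2}$. Then $\chi_\gamma(G)\le M+1$, with equality if and only if $G$ is $\Delta$-regular of order $M+1$, has girth $g(G)=2\gamma+1$ and diameter $\mathrm{diam}(G)=\gamma$ (i.e., $G$ is a Moore graph with degree $\Delta$ and diameter $\gamma$).
   Context: Graphs are finite and simple. The $\gamma$-th power $G^\gamma$ of $G$ is the graph on the vertex set of $G$ in which two distinct vertices are adjacent if and only if their distance in $G$ is at most $\gamma$. $\chi_\gamma(G):=\chi(G^\gamma)$ is the $\gamma$-distance chromatic number, i.e. the chromatic number of $G^\gamma$. The girth $g(G)$ is the length of a shortest cycle, with $g(G)=+\infty$ if $G$ has no cycles. *)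

(* Defs.v *)
From mathcomp Require Import all_boot.

Set Implicit Arguments.
Unset Strict Implicit.
Unset Printing Implicit Defensive.

Record sgraph := SGraph {
  vertex :> finType;
  edge : rel vertex;
  edge_sym : symmetric edge;
  edge_irrefl : irreflexive edge }.

Definition degree (G : sgraph) (x : G) : nat := #|[set y | edge x y]|.

Definition max_degree (G : sgraph) : nat := \max_(x : G) degree x.

Definition regular (G : sgraph) (d : nat) : Prop := forall x : G, degree x = d.

Definition connected (G : sgraph) : Prop :=
  forall x y : G, connect (@edge G) x y.

(* Distance, diameter and girth take values in [option nat], where [None]
   stands for +oo. *)

(* The least [n < N] such that [P n], if any. *)
Definition least_below (N : nat) (P : pred nat) : option nat :=
  ohead [seq n <- iota 0 N | P n].

Definition walk (G : sgraph) (n : nat) (x y : G) : bool :=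
  [exists p : n.-tuple G, path (@edge G) x p && (last x p == y)].

(* The bound loses nothing: see [dist_Some] and [dist_None]. *)
Definition dist (G : sgraph) (x y : G) : option nat :=
  least_below #|G| (fun n => walk n x y).

Definition dist_le (G : sgraph) (n : nat) (x y : G) : bool :=
  if dist x y is Some d then d <= n else false.

Definition diam (G : sgraph) : option nat :=
  if [forall x : G, forall y : G, dist x y != None]
  then Some (\max_(x : G) \max_(y : G) odflt 0 (dist x y))
  else None.

(* [cycle] and [uniq] also hold of the empty sequence and of [:: x; y] for
   every edge x y, hence the lower bound on the length. *)
Definition has_cycle (G : sgraph) (n : nat) : bool :=
  (2 < n) && [exists c : n.-tuple G, cycle (@edge G) c && uniq c].

(* The bound loses nothing: see [girth_Some] and [girth_None]. *)
Definition girth (G : sgraph) : option nat :=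
  least_below #|G|.+1 (has_cycle G).

Lemma least_below_Some N P n :
  least_below N P = Some n <-> [/\ n < N, P n & forall m, P m -> n <= m].
Proof.
rewrite /least_below; split.
- case E: [seq i <- iota 0 N | P i] => [//|k s] /= [ek]; subst k.
  have so : sorted ltn [seq i <- iota 0 N | P i].
    by apply: sorted_filter; [exact: ltn_trans | exact: iota_ltn_sorted].
  have : n \in [seq i <- iota 0 N | P i] by rewrite E mem_head.
  rewrite mem_filter mem_iota => /andP[Pn /= ltn].
  split=> // m Pm; case: (ltnP m N) => [mN|]; last first.
    by move=> Nm; apply: leq_trans (ltnW ltn) Nm.
  have : m \in [seq i <- iota 0 N | P i] by rewrite mem_filter Pm mem_iota.
  rewrite E inE => /orP[/eqP->//|ms].
  move: so; rewrite E /= (path_sortedE ltn_trans) => /andP[/allP /(_ _ ms) h _].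
  exact: ltnW.
- move=> [nN Pn mn].
  have : n \in [seq i <- iota 0 N | P i] by rewrite mem_filter Pn mem_iota.
  have so : sorted ltn [seq i <- iota 0 N | P i].
    by apply: sorted_filter; [exact: ltn_trans | exact: iota_ltn_sorted].
  case E: [seq i <- iota 0 N | P i] so => [//|k s] so.
  have : k \in [seq i <- iota 0 N | P i] by rewrite E mem_head.
  rewrite mem_filter => /andP[Pk _]; rewrite inE => /orP[/eqP->//|ns].
  move: so; rewrite /= (path_sortedE ltn_trans) => /andP[/allP /(_ _ ns) h _].
  by move: (mn _ Pk); rewrite leqNgt h.
Qed.

Lemma least_below_None N P :
  least_below N P = None <-> forall n, n < N -> ~~ P n.
Proof.
rewrite /least_below; split.
- move=> h n nN; apply/negP => Pn.
  have : n \in [seq i <- iota 0 N | P i] by rewrite mem_filter Pn mem_iota.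
  by case: [seq i <- iota 0 N | P i] h.
- move=> h; case E: [seq i <- iota 0 N | P i] => [//|k s].
  have : k \in [seq i <- iota 0 N | P i] by rewrite E mem_head.
  by rewrite mem_filter mem_iota => /andP[Pk /= kN]; rewrite (negPf (h _ kN)) in Pk.
Qed.

Lemma walkP (G : sgraph) n (x y : G) :
  reflect (exists p, [/\ size p = n, path (@edge G) x p & last x p = y])
          (walk n x y).
Proof.
apply: (iffP existsP) => [[p /andP[pp /eqP lp]]|[p [sp pp lp]]].
  by exists p; rewrite size_tuple.
by exists (Tuple (introT eqP sp)); rewrite /= pp lp eqxx.
Qed.

Lemma walk_short (G : sgraph) n (x y : G) :
  walk n x y -> exists m, [/\ m <= n, m < #|G| & walk m x y].
Proof.
move=> /walkP[p [<- pp <-]]; case: (shortenP pp) => q pq uq sq.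
exists (size q); split; last by apply/walkP; exists q.
  by rewrite uniq_leq_size //; case/andP: uq.
by have := max_card (mem (x :: q)); rewrite (card_uniqP uq).
Qed.

Lemma dist_Some (G : sgraph) (x y : G) n :
  dist x y = Some n <-> walk n x y /\ forall m, walk m x y -> n <= m.
Proof.
split; first by move/least_below_Some => [].
move=> [wn mn]; apply/least_below_Some; split=> //.
have [m [_ mG wm]] := walk_short wn; exact: leq_ltn_trans (mn _ wm) mG.
Qed.

Lemma dist_None (G : sgraph) (x y : G) :
  dist x y = None <-> forall n, ~~ walk n x y.
Proof.
split=> [/least_below_None h n|h]; last by apply/least_below_None.
by apply/negP => /walk_short[m [_ mG wm]]; rewrite (negPf (h _ mG)) in wm.
Qed.

Lemma has_cycle_leq (G : sgraph) n : has_cycle G n -> n <= #|G|.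
Proof.
move=> /andP[_ /existsP[c /andP[_ uc]]].
by have := max_card (mem c); rewrite (card_uniqP uc) size_tuple.
Qed.

Lemma girth_Some (G : sgraph) n :
  girth G = Some n <-> has_cycle G n /\ forall m, has_cycle G m -> n <= m.
Proof.
split; first by move/least_below_Some => [].
move=> [cn mn]; apply/least_below_Some; split=> //.
by rewrite ltnS has_cycle_leq.
Qed.

Lemma girth_None (G : sgraph) :
  girth G = None <-> forall n, ~~ has_cycle G n.
Proof.
split=> [/least_below_None h n|h]; last by apply/least_below_None.
by apply/negP => c; have := h n; rewrite ltnS has_cycle_leq // c => /(_ isT).
Qed.

Lemma walk_sym (G : sgraph) n (x y : G) : walk n x y = walk n y x.
Proof.
suff h (u v : G) : walk n u v -> walk n v u by apply/idP/idP; apply: h.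
move=> /walkP[p [sp pp <-]]; apply/walkP; exists (rev (belast u p)); split.
- by rewrite size_rev size_belast.
- by rewrite rev_path; apply: sub_path pp => a b; rewrite edge_sym.
- by case: p sp pp => [//|a p] _ _; rewrite /= rev_cons last_rcons.
Qed.

Lemma dist_sym (G : sgraph) (x y : G) : dist x y = dist y x.
Proof.
rewrite /dist /least_below; congr ohead; apply: eq_filter => n.
exact: walk_sym.
Qed.

Definition power_edge (G : sgraph) (gamma : nat) : rel G :=
  [rel x y | (x != y) && dist_le gamma x y].

Lemma power_edge_sym (G : sgraph) gamma : symmetric (power_edge (G := G) gamma).
Proof. by move=> x y; rewrite /power_edge /= /dist_le eq_sym dist_sym. Qed.

Lemma power_edge_irrefl (G : sgraph) gamma :
  irreflexive (power_edge (G := G) gamma).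
Proof. by move=> x; rewrite /power_edge /= eqxx. Qed.

Definition power (G : sgraph) (gamma : nat) : sgraph :=
  SGraph (@power_edge_sym G gamma) (@power_edge_irrefl G gamma).

Definition colorable (G : sgraph) (k : nat) : bool :=
  [exists c : {ffun G -> 'I_k},
    [forall x : G, forall y : G, edge x y ==> (c x != c y)]].

Lemma colorable_card (G : sgraph) : exists k, colorable G k.
Proof.
exists #|G|; apply/existsP; exists [ffun x => enum_rank x].
apply/forallP => x; apply/forallP => y; apply/implyP => xy.
rewrite !ffunE (inj_eq enum_rank_inj); apply/eqP => exy.
by rewrite exy edge_irrefl in xy.
Qed.

Definition chromatic_number (G : sgraph) : nat := ex_minn (colorable_card G).

Definition dist_chromatic_number (gamma : nat) (G : sgraph) : nat :=
  chromatic_number (power G gamma).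

(* For Delta >= 3 both the subtractions and the division are exact
   ([moore_M_exact]). *)
Definition moore_M (Delta gamma : nat) : nat :=
  Delta * ((Delta - 1) ^ gamma - 1) %/ (Delta - 2).

Lemma moore_M_exact Delta gamma :
  2 < Delta ->
  moore_M Delta gamma * (Delta - 2) = Delta * ((Delta - 1) ^ gamma - 1).
Proof.
move=> D2; rewrite /moore_M divnK // dvdn_mull //.
have -> : Delta - 2 = (Delta - 1).-1 by rewrite -subn1 -subnDA.
by rewrite [_ ^ _ - 1]subn1 predn_exp dvdn_mulr.
Qed.

(* Main.v *)
Require Import Defs.
From mathcomp Require Import all_boot zify.

Set Implicit Arguments.
Unset Strict Implicit.
Unset Printing Implicit Defensive.

(** Write [d = Delta - 1], so that
    [M = Delta * (1 + d + ... + d ^ (gamma - 1))].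

    The upper bound is greedy.  A vertex at distance at most [gamma] from [u]
    is the end of a non-backtracking walk of length at most [gamma] from [u];
    at most [M] of these walks are nonempty, since the first step has at most
    [Delta] choices and every later one at most [d].  Hence the power graph has
    maximum degree at most [M] ([degree_power]).

    For the case of equality, suppose first that some two vertices are more
    than [gamma] apart.  Brooks' theorem would then give an [M]-colouring, and
    Lovasz's proof of it becomes very short here ([lovasz_colorable],
    [power_expansion]).  Crossing the boundary of a ball yields [x], [w], [v]
    with [v] adjacent to both [x] and [w] in the power graph and [x], [w] not
    adjacent in it.  The power graph stays connected when [x] and [w] are
    removed: a walk of [G] enters and leaves a removed vertex through two of
    its neighbours, these are at distance at most 2, and neither of them is the
    other removed vertex.  So one may give [x] and [w] the same colour, then
    colour the other vertices towards [v]: each has an uncoloured neighbour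
    when its turn comes, and [v] itself sees one colour twice.

    So when the chromatic number is [M + 1] all distances are at most [gamma],
    the power graph is complete, and [G] has [M + 1] vertices.  Then the count
    of non-backtracking walks is tight: every degree is [Delta], and two
    distinct non-backtracking walks of length at most [gamma] with the same
    origin have distinct ends ([last_nbwalks_inj]).  The last fact carries the
    rest.  A cycle of length at most [2 * gamma] would split into two such walks
    with the same end ([cycle_gt]).  A non-backtracking walk of length [gamma]
    is a geodesic, which gives the diameter ([moore_dist]); prolonging it by one
    step and returning to the origin within [gamma] steps closes a
    non-backtracking walk of length at most [2 * gamma + 1], and that contains
    a cycle ([cycle_leq]).

    Conversely a graph of diameter [gamma] has a complete power graph, whose
    chromatic number is its order. *)

(** * Greedy colourings *)

Definition proper_on (H : sgraph) k (c : H -> 'I_k) (S : {set H}) : Prop :=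
  {in S &, forall x y, edge x y -> c x != c y}.

Lemma proper_on_setT (H : sgraph) k (c : H -> 'I_k) :
  proper_on c setT -> colorable H k.
Proof.
move=> pc; apply/existsP; exists [ffun x => c x].
apply/forallP => x; apply/forallP => y; apply/implyP => xy.
by rewrite !ffunE pc ?inE.
Qed.

(** The greedy step.  It counts the colours seen by [u] rather than its coloured
    neighbours, because the last vertex coloured in [lovasz_colorable] can have
    as many coloured neighbours as there are colours. *)
Lemma proper_on_extend (H : sgraph) k (c : H -> 'I_k) (S : {set H}) u :
    proper_on c S -> u \notin S ->
    #|c @: ([set z | edge u z] :&: S)| < k ->
  exists2 c' : H -> 'I_k, proper_on c' (u |: S) & {in S, c' =1 c}.
Proof.
move=> pc uS lt.
have [j jN] : exists j : 'I_k, j \notin c @: ([set z | edge u z] :&: S).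
  apply/existsP; apply: contraLR lt; rewrite negb_exists -leqNgt.
  move=> /forallP all.
  rewrite -[X in X <= _](card_ord k).
  by apply/subset_leq_card/subsetP => j _; have := all j; rewrite negbK.
have jc z : z \in S -> edge u z -> j != c z.
  move=> zS uz; apply: contraNneq jN => ->.
  by apply: imset_f; rewrite !inE uz.
exists (fun z => if z == u then j else c z) => [a b|z zS]; last first.
  by case: eqP zS uS => // -> ->.
rewrite !inE; case: (eqVneq a u) => [->|au]; case: (eqVneq b u) => [->|bu] //=.
- by rewrite edge_irrefl.
- by move=> _; apply: jc.
- by move=> aS _; rewrite edge_sym eq_sym; apply: jc.
- exact: pc.
Qed.

Lemma greedy_colorable (H : sgraph) k :
  (forall u : H, degree u <= k) -> colorable H k.+1.
Proof.
move=> dk.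
suff claim n (S : {set H}) : #|S| <= n ->
    exists c : H -> 'I_k.+1, proper_on c S.
  by have [c /proper_on_setT] := claim _ [set: H] (leqnn _).
elim: n S => [|n IH] S.
  rewrite leqn0 cards_eq0 => /eqP->; exists (fun=> ord0) => a b.
  by rewrite inE.
case: (set_0Vmem S) => [->|[u uS]].
  by move=> _; apply: IH; rewrite cards0.
rewrite (cardsD1 u) uS ltnS => /IH[c pc].
have [||c' pc' _] := proper_on_extend (u := u) pc; first by rewrite !inE eqxx.
  rewrite ltnS (leq_trans (leq_imset_card _ _)) //.
  exact: leq_trans (subset_leq_card (subsetIl _ _)) (dk u).
by exists c'; rewrite -(setD1K uS).
Qed.

(** The core of Lovasz's proof of Brooks' theorem.  The last hypothesis says
    that [H] minus [x] and [y] is connected, in the form that the colouring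
    consumes: as long as the set [T] of vertices to be coloured later is not
    everything but [x] and [y], it can be enlarged by a vertex [w] adjacent to
    it, and [w], when it is coloured, still has an uncoloured neighbour. *)
Lemma lovasz_colorable (H : sgraph) k (x y v : H) :
    (forall u : H, degree u <= k) ->
    edge v x -> edge v y -> x != y -> ~~ edge x y ->
    (forall T : {set H}, T \subset ~: [set x; y] -> v \in T ->
       T != ~: [set x; y] ->
       exists t w, [/\ t \in T, w \notin T, w \notin [set x; y] & edge t w]) ->
  colorable H k.
Proof.
move=> dk vx vy xy nxy conn.
have vx' : v != x by apply: contraTneq vx => ->; rewrite edge_irrefl.
have vy' : v != y by apply: contraTneq vy => ->; rewrite edge_irrefl.
(* Colour everything outside [T], by induction on the size of [~: T]: the
   vertex coloured last is the one that enlarges [T]. *)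
have claim n (T : {set H}) : #|~: T| <= n -> T \subset ~: [set x; y] ->
    v \in T -> exists2 c : H -> 'I_k, proper_on c (~: T) & c x = c y.
  elim: n T => [|n IH] T.
    rewrite leqn0 cards_eq0 => /eqP T0 /subsetP/(_ x).
    by rewrite -[T]setCK T0 !inE eqxx => /(_ isT).
  move=> Tn Txy vT; case: (eqVneq T (~: [set x; y])) => [->|Tne].
    have k0 : 0 < k.
      by apply: leq_trans (dk v); apply/card_gt0P; exists x; rewrite inE.
    exists (fun=> Ordinal k0) => // a b; rewrite setCK !inE.
    by do 2!case/orP => /eqP->; rewrite ?edge_irrefl ?(negPf nxy) //
      edge_sym (negPf nxy).
  have [t [w [tT wT wxy tw]]] := conn _ Txy vT Tne.
  have CT : ~: (w |: T) = ~: T :\ w by rewrite setDE setCU setIC.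
  have wCT : w \in ~: T by rewrite inE.
  have [|||c pc cxy] := IH (w |: T).
  - by rewrite CT; move: Tn; rewrite (cardsD1 w) wCT.
  - by rewrite subUset Txy sub1set inE wxy.
  - by rewrite inE vT orbT.
  have [||c' pc' cc'] := proper_on_extend (u := w) pc.
  - by rewrite !inE eqxx.
  - apply: leq_ltn_trans (leq_imset_card _ _) _.
    apply: leq_trans (dk w); apply/proper_card/properP.
    split; first exact: subsetIl.
    by exists t; rewrite !inE 1?edge_sym // tT orbT andbF.
  exists c'; first by rewrite -(setD1K wCT) -CT.
  have mem z : z \in [set x; y] -> z \in ~: (w |: T).
    move=> zxy; rewrite CT !inE; apply/andP; split.
      by apply: contraNneq wxy => <-.
    by apply: contraL zxy => /(subsetP Txy); rewrite inE.
  by rewrite !cc' ?mem // !inE eqxx ?orbT.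
have [||c pc cxy] := claim _ [set v] (leqnn _).
- by rewrite sub1set !inE negb_or vx' vy'.
- by rewrite inE.
have [||c' pc' _] := proper_on_extend (u := v) pc; first by rewrite !inE eqxx.
  (* As [x] and [y] share their colour, the colours seen by [v] are those of
     its neighbours other than [y]. *)
  have -> : c @: ([set z | edge v z] :&: ~: [set v])
          = c @: (([set z | edge v z] :&: ~: [set v]) :\ y).
    apply/setP => j; apply/imsetP/imsetP => -[z zN ->]; last first.
      by exists z => //; move: zN; rewrite in_setD1 => /andP[].
    case: (eqVneq z y) => [->|zy]; last by exists z; rewrite // in_setD1 zy.
    by exists x => //; rewrite !inE xy vx eq_sym vx'.
  apply: leq_ltn_trans (leq_imset_card _ _) _.
  apply: leq_trans (dk v); apply/proper_card/properP; split.
    exact: subset_trans (subD1set _ _) (subsetIl _ _).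
  by exists y; rewrite !inE ?eqxx.
by apply: (@proper_on_setT _ _ c'); rewrite -(setUCr [set v]).
Qed.

Lemma colorable_card_vertices (H : sgraph) : colorable H #|H|.
Proof.
apply: (@proper_on_setT _ _ enum_rank) => x y _ _ xy.
by rewrite (inj_eq enum_rank_inj); apply: contraTneq xy => ->;
  rewrite edge_irrefl.
Qed.

Lemma chromatic_number_leq (H : sgraph) k :
  colorable H k -> chromatic_number H <= k.
Proof. by rewrite /chromatic_number; case: ex_minnP => m _ min /min. Qed.

Lemma chromatic_number_complete (H : sgraph) :
  (forall x y : H, x != y -> edge x y) -> chromatic_number H = #|H|.
Proof.
move=> complete; apply/eqP; rewrite eqn_leq chromatic_number_leq /=; last first.
  exact: colorable_card_vertices.
rewrite /chromatic_number; case: ex_minnP => m /existsP[c pc] _.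
rewrite -[m in _ <= m]card_ord; apply: (leq_card c) => x y.
move/eqP; apply: contraTeq => /complete xy.
by move/forallP/(_ x)/forallP/(_ y)/implyP/(_ xy): pc.
Qed.

(** * Colouring powers of a connected graph *)

Lemma connected_boundary (G : sgraph) (S : {set G}) a b :
    connected G -> a \in S -> b \notin S ->
  exists t w, [/\ t \in S, w \notin S & edge t w].
Proof.
move=> conn aS bS.
have [/existsP[t /existsP[w /and3P[tS wS tw]]]|noedge] :=
    boolP [exists t, [exists w, [&& t \in S, w \notin S & edge t w]]].
  by exists t, w.
have cl : closed (@edge G) (mem S).
  apply: intro_closed => [|t w tw tS]; first exact/sym_connect_sym/edge_sym.
  apply: contraNT noedge => wS.
  by apply/existsP; exists t; apply/existsP; exists w; apply/and3P.
by move: bS; rewrite -(closed_connect cl (conn a b)) aS.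
Qed.

Lemma dist_leP (G : sgraph) n (x y : G) :
  reflect (exists2 m, m <= n & walk m x y) (dist_le n x y).
Proof.
rewrite /dist_le; case E: (dist x y) => [d|].
  have [wd dmin] := (dist_Some x y d).1 E.
  apply: (iffP idP) => [dn|[m mn /dmin dm]]; first by exists d.
  exact: leq_trans mn.
by constructor=> -[m _]; rewrite (negPf ((dist_None x y).1 E m)).
Qed.

Lemma dist_le_refl (G : sgraph) n (x : G) : dist_le n x x.
Proof. by apply/dist_leP; exists 0 => //; apply/walkP; exists [::]. Qed.

Lemma dist_le1 (G : sgraph) n (x y : G) : 0 < n -> edge x y -> dist_le n x y.
Proof.
by move=> n0 xy; apply/dist_leP; exists 1 => //; apply/walkP; exists [:: y];
  rewrite /= xy.
Qed.

Lemma dist_le2 (G : sgraph) n (x y z : G) :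
  1 < n -> edge x y -> edge y z -> dist_le n x z.
Proof.
by move=> n0 xy yz; apply/dist_leP; exists 2 => //; apply/walkP;
  exists [:: y; z]; rewrite /= xy yz.
Qed.

(** Removing two nonadjacent vertices [x], [y] of [G] leaves a power graph
    connected.  To see it, add to [T] those of [x] and [y] that have a
    [G]-neighbour in [T].  An edge of [G] leaving the enlarged set starts in
    [T], or in [x] or [y] and is then preceded by an edge from [T]; in both
    cases it ends outside [x] and [y], within distance 2 of [T]. *)
Lemma power_expansion (G : sgraph) n (x y : G) (T : {set power G n}) v :
    connected G -> 1 < n -> ~~ edge x y -> T \subset ~: [set x; y] -> v \in T ->
    T != ~: [set x; y] ->
  exists t w : power G n,
    [/\ t \in T, w \notin T, w \notin [set x; y] & edge t w].
Proof.
move=> conn n1 nxy Txy vT Tne.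
pose near z := [exists t in T, @edge G t z].
pose T' : {set G} := T :|: [set z in [set x; y] | near z].
have [w0] : exists w0, w0 \in ~: [set x; y] :\: T.
  by apply/set0Pn; apply: contra Tne; rewrite setD_eq0 eqEsubset Txy.
rewrite inE [in X in _ && X]inE => /andP[w0T w0xy].
have w0T' : w0 \notin T'.
  by rewrite in_setU (negPf w0T) inE (negPf w0xy).
have vT' : v \in T' by rewrite inE vT.
have [a [b [aT' bT' ab]]] := connected_boundary conn vT' w0T'.
have bT : b \notin T by apply: contra bT' => bT; rewrite inE bT.
have tb t : t \in T -> b \notin [set x; y] -> @dist_le G n t b ->
    exists t w : power G n,
    [/\ t \in T, w \notin T, w \notin [set x; y] & edge t w].
  move=> tT bxy dtb; exists t, b; split => //.
  by rewrite /= /power_edge /= dtb andbT; apply: contraNneq bT => <-.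
move: aT'; rewrite in_setU => /orP[aT|].
  apply: (tb a) => //; last exact/dist_le1/ab/ltnW.
  apply: contra bT' => bxy; rewrite in_setU; apply/orP; right.
  by rewrite inE bxy; apply/existsP; exists a; rewrite aT.
rewrite inE => /andP[axy /existsP[t /andP[tT ta]]].
apply: (tb t) => //; last exact: dist_le2 ta ab.
apply: contraL ab; move: axy; rewrite !inE.
by do 2!case/orP => /eqP->; rewrite ?edge_irrefl ?(negPf nxy) //
      edge_sym (negPf nxy).
Qed.

(** The end [w] of an edge [z w] that leaves the ball around [x] is not
    adjacent to [x] in the power, while [z] is adjacent to both. *)
Lemma power_colorable (G : sgraph) n k (x y : G) :
    connected G -> 1 < n -> ~~ dist_le n x y ->
    (forall u : power G n, degree u <= k) ->
  colorable (power G n) k.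
Proof.
move=> conn n1 far dk.
have n0 : 0 < n by apply: ltnW.
have [||z [w [zS wS zw]]] :=
    @connected_boundary G [set z | dist_le n x z] x y conn.
- by rewrite inE dist_le_refl.
- by rewrite inE.
rewrite !inE in zS wS.
have xz : x != z by apply: contraNneq wS => ->; apply: dist_le1.
have xw : x != w by apply: contraNneq wS => <-; apply: dist_le_refl.
apply: (@lovasz_colorable (power G n) k x w z dk).
- by rewrite edge_sym /= /power_edge /= xz.
- rewrite /= /power_edge /= dist_le1 // andbT.
  by apply: contraTneq zw => ->; rewrite edge_irrefl.
- exact: xw.
- by rewrite /= /power_edge /= negb_and wS orbT.
move=> T; apply: power_expansion => //.
by apply: contra wS; apply: dist_le1.
Qed.

(** * Counting non-backtracking walks *)

(** [a] is the vertex visited just before [x], to which the first step may not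
    return.  Taking [a = x] leaves the first step free, as edges are not
    loops; walks with no past are therefore written [nbpath x x p]. *)
Fixpoint nbpath (G : sgraph) (a x : G) (p : seq G) : bool :=
  if p is y :: p' then [&& edge x y, y != a & nbpath x y p'] else true.

(** The continuations of length at most [n], as a list, so that their number is
    a [size]. *)
Fixpoint nbwalks (G : sgraph) (n : nat) (a x : G) : seq (seq G) :=
  [::] :: if n is n'.+1 then
    [seq y :: p | y <- enum [set y | edge x y & y != a], p <- nbwalks n' x y]
  else [::].

Lemma mem_nbwalks (G : sgraph) n (a x : G) p :
  (p \in nbwalks n a x) = (size p <= n) && nbpath a x p.
Proof.
elim: n a x p => [|n IH] a x [|y p] //=.
rewrite inE /= ltnS; apply/allpairsPdep/idP => [[z [q [zN qN [-> ->]]]]|].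
  by move: zN qN; rewrite mem_enum inE IH => /andP[-> ->] /andP[-> ->].
move/and4P => [sp xy ya pp]; exists y, p.
by rewrite mem_enum inE xy ya IH sp pp.
Qed.

Lemma size_nbwalks_step (G : sgraph) n (a x : G) m :
    (forall y, edge x y -> size (nbwalks n x y) <= m) ->
  size (nbwalks n.+1 a x) <= (#|[set y | edge x y & y != a]| * m).+1.
Proof.
move=> bound; rewrite /= ltnS size_allpairs_dep sumnE big_map big_enum.
rewrite -sum_nat_const; apply: leq_sum => y; rewrite inE => /andP[xy _].
exact: bound.
Qed.

Lemma size_nbwalks (G : sgraph) d n (a x : G) :
    (forall u : G, degree u <= d.+1) -> edge x a ->
  size (nbwalks n a x) <= \sum_(i < n.+1) d ^ i.
Proof.
move=> dd; elim: n a x => [|n IH] a x xa; first by rewrite big_ord1.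
rewrite big_ord_recl; under eq_bigr do rewrite expnS.
rewrite -big_distrr /= add1n.
apply: leq_trans (size_nbwalks_step _ _) _ => [y xy|].
  by apply: IH; rewrite edge_sym.
rewrite ltnS leq_mul2r; apply/orP; right.
have := dd x; rewrite /degree (cardsD1 a) inE xa ltnS; apply: leq_trans.
by apply/subset_leq_card/subsetP => y; rewrite !inE andbC.
Qed.

Lemma size_nbwalks_root (G : sgraph) d n (x : G) :
    (forall u : G, degree u <= d.+1) ->
  size (nbwalks n x x) <= (degree x * \sum_(i < n) d ^ i).+1.
Proof.
move=> dd; case: n => [|n]; first by rewrite big_ord0 muln0.
apply: leq_trans (size_nbwalks_step _ _) _ => [y xy|].
  by apply: size_nbwalks; rewrite 1?edge_sym //; apply: dd.
rewrite ltnS leq_mul2r; apply/orP; right.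
by apply/subset_leq_card/subsetP => y; rewrite !inE => /andP[].
Qed.

Lemma uniq_nbpath (G : sgraph) (a x : G) p :
  uniq (x :: p) -> a \notin p -> path (@edge G) x p -> nbpath a x p.
Proof.
elim: p a x => [|y p IH] a x //= /andP[xp up]; rewrite inE negb_or eq_sym.
case/andP=> -> ap /andP[-> pp] /=.
by apply: IH => //; apply: contra xp; rewrite inE orbC => ->.
Qed.

Lemma walk_nbpath (G : sgraph) n (x y : G) :
    walk n x y ->
  exists q, [/\ size q <= n, nbpath x x q & last x q = y].
Proof.
move=> /walkP[p [<- pp <-]]; case: (shortenP pp) => q pq uq sq.
have /= /andP[xq uq'] := uq.
by exists q; split=> //; [apply: uniq_leq_size | apply: uniq_nbpath].
Qed.

Lemma nbpath_path (G : sgraph) (a x : G) p : nbpath a x p -> path (@edge G) x p.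
Proof. by elim: p a x => [|y p IH] a x //= /and3P[-> _ /IH]. Qed.

Lemma ball_sub (G : sgraph) n (x : G) :
  [set y | dist_le n x y] \subset [seq last x p | p <- nbwalks n x x].
Proof.
apply/subsetP => y; rewrite inE => /dist_leP[m mn /walk_nbpath[q [sq nq <-]]].
by apply: map_f; rewrite mem_nbwalks nq (leq_trans sq).
Qed.

Lemma card_ball (G : sgraph) d n (x : G) :
    (forall u : G, degree u <= d.+1) ->
  #|[set y | dist_le n x y]| <= (degree x * \sum_(i < n) d ^ i).+1.
Proof.
move=> dd; apply: leq_trans (size_nbwalks_root n x dd).
rewrite -(size_map (last x)); apply: leq_trans (card_size _).
exact/subset_leq_card/ball_sub.
Qed.

Lemma degree_power (G : sgraph) d n (x : power G n) :
    (forall u : G, degree u <= d.+1) ->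
  degree x <= d.+1 * \sum_(i < n) d ^ i.
Proof.
move=> dd; have := @card_ball G d n x dd.
rewrite (cardsD1 (x : G)) inE dist_le_refl add1n ltnS => ball.
apply: leq_trans (leq_mul (dd x) (leqnn _)); apply: leq_trans ball.
by apply/subset_leq_card/subsetP => y; rewrite !inE eq_sym.
Qed.

(** If the walks are at most as many as their possible ends, and every vertex
    is an end, no two of them share their end. *)
Lemma last_nbwalks_inj (G : sgraph) n (x : G) :
    (forall y, dist_le n x y) -> size (nbwalks n x x) <= #|G| ->
  {in nbwalks n x x &, injective (last x)}.
Proof.
move=> full sz.
set L := nbwalks n x x in sz *.
have uL : uniq [seq last x p | p <- L].
  apply: (@leq_size_uniq _ (enum G)); first exact: enum_uniq.
    by move=> y _; apply: (subsetP (ball_sub n x)); rewrite inE full.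
  by rewrite size_map -cardE.
move=> p q pL qL epq.
have lx r : r \in L -> last x r = nth x [seq last x p | p <- L] (index r L).
  by move=> rL; rewrite (nth_map [::]) ?index_mem // nth_index.
have /eqP := epq; rewrite (lx p) // (lx q) // nth_uniq ?size_map ?index_mem //.
by move/eqP => eidx; rewrite -(nth_index [::] pL) eidx nth_index.
Qed.

Lemma nbpath_exists (G : sgraph) (a x : G) n :
    (forall u : G, 2 <= degree u) ->
  exists2 p, size p = n & nbpath a x p.
Proof.
move=> d2; elim: n a x => [|n IH] a x; first by exists [::].
have [y] : exists y, y \in [set y | edge x y] :\ a.
  apply/set0Pn; rewrite -card_gt0; have := d2 x; rewrite /degree (cardsD1 a).
  by case: (a \in _) => //; apply: leq_trans.
rewrite !inE => /andP[ya xy]; have [p sp np] := IH x y.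
by exists (y :: p); rewrite /= ?sp // xy ya.
Qed.

(** * Cycles and non-backtracking walks *)

Lemma has_cycleP (G : sgraph) (x : G) s :
    1 < size s -> uniq (x :: s) -> path (@edge G) x s -> edge (last x s) x ->
  has_cycle G (size s).+1.
Proof.
move=> s1 us ps lsx; rewrite /has_cycle ltnS s1; apply/existsP.
exists (in_tuple (x :: s)); apply/andP; split; last exact: us.
by rewrite /= rcons_path ps.
Qed.

(** Two visits to a vertex with no repetition in between bound a cycle: their
    distance along the walk is not 1 because edges are not loops, and not 2
    because the walk does not backtrack. *)
Lemma nbpath_cycle (G : sgraph) (a x : G) p :
    nbpath a x p -> ~~ uniq (x :: p) ->
  exists2 m, m <= size p & has_cycle G m.
Proof.
elim: p a x => [|y p IH] a x // nb.
have /= /and3P[xy ya nb'] := nb.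
have [up|nup _] := boolP (uniq (y :: p)); last first.
  by have [m mp cm] := IH _ _ nb' nup; exists m => //; apply: leqW.
rewrite -[_ && uniq p]/(uniq (y :: p)) up andbT negbK inE => /orP[/eqP exy|xp].
  by rewrite exy edge_irrefl in xy.
case/splitPr: xp nb' up => p1 p2 nb' up.
exists (size (y :: p1)).+1.
  by rewrite /= size_cat /= addnS !ltnS leq_addr.
move/nbpath_path: (nb'); rewrite cat_path /= => /and3P[pp1 lx _].
apply: (@has_cycleP G x (y :: p1)); rewrite /= ?xy //.
  case: p1 nb' {up pp1 lx} => [|z p1] //= /and3P[].
  by rewrite eqxx.
move: up; rewrite /= mem_cat cat_uniq /= !inE !negb_or.
move=> /andP[/and3P[yp1 yx _] /and3P[-> /andP[xp1 _] _]].
by rewrite yp1 eq_sym yx xp1.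
Qed.

Lemma nbpath_cat (G : sgraph) (a x z : G) p q :
    nbpath a x (rcons p z) -> nbpath z z q ->
    (if q is y :: _ then y != last x p else true) ->
  nbpath a x (rcons p z ++ q).
Proof.
elim: p a x => [|y p IH] a x /=.
  by move=> /and3P[-> -> _]; case: q => [|y q] //= /and3P[-> _ ->] ->.
by move=> /and3P[-> -> np] nq turn; rewrite IH.
Qed.

Lemma nbpath_rcons (G : sgraph) (a x z : G) p :
  nbpath a x (rcons p z) -> nbpath a x p.
Proof. by elim: p a x => [|y p IH] a x //= /and3P[-> -> /IH]. Qed.

(** A cycle of length at most [2 * n] is made of two paths with the same ends
    and lengths at most [n].  They differ, since their interiors are disjoint
    and one of them is nonempty. *)
Lemma cycle_gt (G : sgraph) n m :
    (forall x : G, {in nbwalks n x x &, injective (last x)}) ->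
  has_cycle G m -> 2 * n < m.
Proof.
move=> inj /andP[m2 /existsP[c /andP[]]].
case: c => -[|x s] /= /eqP sm; first by move: m2; rewrite -sm.
move=> cs us.
rewrite ltnNge; apply/negP => mn.
(* [y] is the vertex of the cycle opposite to [x]. *)
have [s1 [y [s2 [es s1n s2n s2pos]]]] : exists s1 y s2,
    [/\ s = s1 ++ y :: s2, size s1 < n, size s2 < n & 0 < size s2].
  exists (take m./2.-1 s), (nth x s m./2.-1), (drop m./2 s).
  rewrite size_take_min size_drop; split; [|lia..].
  have -> : m./2 = m./2.-1.+1 by lia.
  by rewrite -drop_nth ?cat_take_drop //; lia.
rewrite {}es /= rcons_cat cat_path /= in cs us.
move: cs us => /and3P[ps1 s1y ps2] /andP[xs us].
have ps2' : path (@edge G) x (rcons (rev s2) y).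
  have := rev_path (@edge G) y (rcons s2 x).
  rewrite last_rcons belast_rcons rev_cons => ->.
  by apply: sub_path ps2 => a b; rewrite edge_sym.
move: xs us; rewrite mem_cat inE !negb_or cat_uniq /= negb_or.
move=> /and3P[xs1 xy xs2] /and4P[us1 /andP[ys1 s12] ys2 us2].
have /inj/(_ _)/= : rcons s1 y \in nbwalks n x x.
  rewrite mem_nbwalks size_rcons s1n uniq_nbpath //.
  - by rewrite /= rcons_uniq mem_rcons inE negb_or xy xs1 ys1.
  - by rewrite mem_rcons inE negb_or xy xs1.
  - by rewrite rcons_path ps1.
move/(_ (rcons (rev s2) y)); rewrite !last_rcons => eqr.
have /rcons_inj[e12] : rcons s1 y = rcons (rev s2) y.
  apply: eqr => //; rewrite mem_nbwalks size_rcons size_rev s2n uniq_nbpath //.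
    by rewrite /= rcons_uniq mem_rcons inE negb_or !mem_rev rev_uniq xy xs2 ys2.
  by rewrite mem_rcons inE negb_or mem_rev xy.
move/negP: s12; apply; apply/hasP.
case: s2 s2pos e12 {xs2 ys2 us2 ps2 ps2' eqr s2n} => // z s2 _ ->.
by exists z; rewrite ?mem_rev mem_head.
Qed.

(** Prolong a non-backtracking walk of length [n] by one step, to [z], and
    return to [x] by a walk of length at most [n].  There is no backtracking at
    [z], for otherwise the vertex before [z] would be within [n - 1] steps of
    [x], yet it is the end of a non-backtracking walk of length [n], and by
    injectivity of no shorter one. *)
Lemma cycle_leq (G : sgraph) n (x : G) :
    (forall u v : G, dist_le n u v) -> (forall u : G, 2 <= degree u) ->
    {in nbwalks n x x &, injective (last x)} ->
  exists2 m, m <= 2 * n + 1 & has_cycle G m.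
Proof.
move=> full d2 inj; have [p] := nbpath_exists x x n.+1 d2.
case: (lastP p) => // p' z; rewrite size_rcons => -[sp'] np.
have /dist_leP[k kn /walk_nbpath[q [sq nq lq]]] := full z x.
have turn : (if q is y :: _ then y != last x p' else true) : bool.
  case: q sq nq lq => // y q sq nq lq; apply/eqP => ey.
  have : walk (size q) x (last x p').
    rewrite walk_sym -ey; apply/walkP; exists q; split=> //.
    by move/nbpath_path: nq => /andP[].
  case/walk_nbpath => r [sr nr lr].
  have er : r = p'.
    apply: inj => //; rewrite mem_nbwalks ?nr ?(nbpath_rcons np) ?sp' ?leqnn //.
    by rewrite andbT; move: sq => /=; lia.
  by move: sr sq; rewrite er sp' /=; lia.
have nc := nbpath_cat np nq turn.
have [|m mle cm] := nbpath_cycle nc.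
  have lx : last x (rcons p' z ++ q) = x by rewrite last_cat last_rcons.
  rewrite cons_uniq negb_and negbK -{1}lx.
  by case: (p') => [|b p''] /=; rewrite mem_last.
exists m => //; apply: leq_trans mle _.
by rewrite size_cat size_rcons sp'; lia.
Qed.

(** * Moore graphs *)

Lemma complete_power (G : sgraph) n :
    (forall u v : G, dist_le n u v) ->
  dist_chromatic_number n G = #|G|.
Proof.
move=> full; apply: (@chromatic_number_complete (power G n)) => u v uv.
by rewrite /= /power_edge /= uv full.
Qed.

Lemma diam_leqP (G : sgraph) n :
  diam G = Some n -> forall u v : G, dist_le n u v.
Proof.
rewrite /diam; case: ifP => // /forallP all [<-] u v.
have /forallP/(_ v) := all u; rewrite /dist_le.
case E: (dist u v) => [d|] // _.
apply: leq_trans (leq_bigmax u); apply: leq_trans (leq_bigmax v).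
by rewrite E.
Qed.

Lemma diam_eq (G : sgraph) n (x y : G) :
    (forall u v : G, dist_le n u v) -> dist x y = Some n ->
  diam G = Some n.
Proof.
move=> full dxy; rewrite /diam ifT; last first.
  apply/forallP => u; apply/forallP => v; have := full u v.
  by rewrite /dist_le; case: dist.
congr Some; apply/eqP; rewrite eqn_leq; apply/andP; split.
  apply/bigmax_leqP => u _; apply/bigmax_leqP => v _; have := full u v.
  by rewrite /dist_le; case: dist.
apply: leq_trans (leq_bigmax x); apply: leq_trans (leq_bigmax y).
by rewrite dxy.
Qed.

(** The end of a non-backtracking walk of length [n] is at distance exactly
    [n], since a shorter walk to it would be another one with the same end. *)
Lemma moore_dist (G : sgraph) n (x : G) :
    (forall u : G, 2 <= degree u) ->
    {in nbwalks n x x &, injective (last x)} ->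
  exists y, dist x y = Some n.
Proof.
move=> d2 inj; have [p sp np] := nbpath_exists x x n d2.
exists (last x p); apply/dist_Some; split.
  by apply/walkP; exists p; rewrite (nbpath_path np).
move=> m wm; rewrite leqNgt; apply/negP => mn.
have [q [sq nq lq]] := walk_nbpath wm.
suff eqp : q = p by move: sq; rewrite eqp sp leqNgt mn.
apply: inj => //; rewrite mem_nbwalks ?nq ?np ?sp ?leqnn ?andbT //.
exact: leq_trans sq (ltnW mn).
Qed.

Lemma moore_M_sum d n : 1 < d -> moore_M d.+1 n = d.+1 * \sum_(i < n) d ^ i.
Proof.
move=> d1; rewrite /moore_M subSS subn0 subn1 predn_exp subSS subn1.
by rewrite mulnCA mulKn //; case: d d1 => [|[]].
Qed.

Lemma degree_leq_max (G : sgraph) (u : G) : degree u <= max_degree G.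
Proof. exact: leq_bigmax. Qed.

(** [#|G|] attains the bound on the number of walks at every vertex, so that
    degrees cannot be smaller than allowed and ends cannot coincide. *)
Lemma moore_properties (G : sgraph) d n (x0 : G) :
    0 < n -> (forall u : G, degree u <= d.+2) ->
    (forall u v : G, dist_le n u v) ->
    #|G| = (d.+2 * \sum_(i < n) d.+1 ^ i).+1 ->
  [/\ regular G d.+2, girth G = Some (2 * n).+1 & diam G = Some n].
Proof.
move=> n0 dd full cG.
have inj (x : G) : {in nbwalks n x x &, injective (last x)}.
  have sz : size (nbwalks n x x) <= #|G|.
    rewrite cG; apply: leq_trans (size_nbwalks_root n x dd) _.
    by rewrite ltnS leq_mul2r dd orbT.
  exact: last_nbwalks_inj (full x) sz.
have reg : regular G d.+2.
  move=> u; apply/eqP; rewrite eqn_leq dd /=.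
  have := card_ball n u dd.
  have -> : [set y | dist_le n u y] = setT.
    by apply/setP => y; rewrite !inE full.
  rewrite cardsT cG ltnS leq_mul2r; case: n n0 {full cG inj} => // n _.
  by rewrite big_ord_recl.
have d2 (u : G) : 2 <= degree u by rewrite reg.
split=> //; last first.
  by have [y] := moore_dist d2 (inj x0); apply: diam_eq.
have [m mn cm] := cycle_leq full d2 (inj x0).
have em : m = (2 * n).+1 by have := cycle_gt inj cm; lia.
apply/girth_Some; split; first by rewrite -em.
by move=> k /(cycle_gt inj).
Qed.

Theorem theorem2p1 (gamma : nat) (hgamma : 2 <= gamma)
    (G : sgraph) (hconn : connected G)
    (Delta : nat) (hDelta : max_degree G = Delta) (hDelta3 : 3 <= Delta) :
  let M := moore_M Delta gamma in
  dist_chromatic_number gamma G <= M + 1 /\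
  (dist_chromatic_number gamma G = M + 1 <->
     [/\ regular G Delta, #|G| = M + 1,
         girth G = Some (2 * gamma + 1) & diam G = Some gamma]).
Proof.
have dd (u : G) : degree u <= Delta by rewrite -hDelta degree_leq_max.
case: Delta hDelta3 dd hDelta => [|[|d]] // d1 dd hDelta.
have [x0 _] : exists x0 : G, true.
  have [//|nG] := boolP [exists x0 : G, true]; first by move/existsP.
  move: d1; rewrite -hDelta /max_degree big_pred0 // => x.
  by move/existsP: nG; case; exists x.
rewrite moore_M_sum //= !addn1; set M := _ * _.
have dpow (u : power G gamma) : degree u <= M by apply: degree_power.
split; first exact/chromatic_number_leq/greedy_colorable.
split=> [chi|[_ cG _ /diam_leqP full]]; last by rewrite complete_power.
have full (u v : G) : dist_le gamma u v.
  apply: contraPT chi => far.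
  have := chromatic_number_leq (power_colorable hconn hgamma far dpow).
  by rewrite /dist_chromatic_number => le e; rewrite e ltnn in le.
rewrite complete_power // in chi.
by have [] := moore_properties x0 (ltnW hgamma) dd full chi.
Qed.
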